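(* Let $H=\bigoplus_{n\ge0}H_n$ be a graded connected bialgebra. (1) The Heisenberg product of $\mathrm{End}(H)$ restricts to $\mathrm{End}_{\mathrm{gr}}(H)$. Moreover, if $f\in\mathrm{End}(H_p)$ and $g\in\mathrm{End}(H_q)$, then $$f\#g\in\bigoplus_{n=\max(p,q)}^{p+q}\mathrm{End}(H_n),$$ and the top and bottom components of $f\#g$ are $$(f\#g)_{p+q}=f\star g\quad\text{and, if }p=q,\quad (f\#g)_p=g\circ f.$$ (2) If $f=\alpha|k\in\mathrm{End}(H_p)$ and $g=\beta|\ell\in\mathrm{End}(H_q)$ (with $\alpha\in H_p^*$, $k\in H_p$, $\beta\in H_q^*$, $\ell\in H_q$), then $$\alpha|k\,\#\,\beta|\ell=\sum_{0\le n\le\min(p,q)}\alpha(k_n\rightharpoonup\beta)\,|\,k_{p-n}\ell,$$ where $\Delta(k)=\sum_n k_n\otimes k_{p-n}$ with $k_n\in H_n$ and $k_{p-n}\in H_{p-n}$. Hence the Heisenberg product of $\mathrm{End}(H)$ also restricts to $\mathrm{end}_f(H)=\bigoplus_n\mathrm{End}_f(H_n)$.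
   Context: Spaces are over a field $\Bbbk$ of characteristic zero; Sweedler notation is used. A graded connected bialgebra satisfies $H_nH_m\subseteq H_{n+m}$, $\Delta(H_n)\subseteq\bigoplus_{p+q=n}H_p\otimes H_q$ and $H_0=\Bbbk$ (hence it is a Hopf algebra). $\mathrm{End}(H)$ is the space of linear endomorphisms; $\mathrm{End}_{\mathrm{gr}}(H)=\prod_n\mathrm{End}(H_n)$ is the subspace of degree preserving ones; $f\in\mathrm{End}(H_p)$ is viewed as an endomorphism of $H$ equal to $0$ on $H_n$, $n\ne p$; for $f\in\mathrm{End}_{\mathrm{gr}}(H)$, $f_n$ denotes its component in $\mathrm{End}(H_n)$. $\mathrm{End}_f$ denotes finite rank endomorphisms. The Heisenberg product is $(f\#g)(h)=\sum f(h_1)_2\,g\bigl(h_2f(h_1)_1\bigr)$; convolution is $(f\star g)(h)=\sum f(h_1)g(h_2)$; $\circ$ is composition. For $\alpha\in H^*$ and $h\in H$, $\alpha|h$ is the rank $\leq 1$ endomorphism $(\alpha|h)(h')=\alpha(h')h$. Functionals on $H_p$ are extended by $0$ to $H$. $H^*$ has the product dual to $\Delta$: $(\alpha\beta)(x)=\sum\alpha(x_1)\beta(x_2)$, and $(h\rightharpoonup\beta)(x)=\beta(xh)$. In the formula of (2), the expression $k_n\otimes k_{p-n}$ stands for the (Sweedler-summed) component of $\Delta(k)$ in $H_n\otimes H_{p-n}$, and $\alpha(k_n\rightharpoonup\beta)$ is the product in $H^*$. *)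

(* Defs.v *)
From HB Require Import structures.
From mathcomp Require Import all_boot all_order all_algebra.
From mathcomp Require Import boolp.

Set Implicit Arguments.
Unset Strict Implicit.
Unset Printing Implicit Defensive.

Import GRing.Theory.
Local Open Scope ring_scope.
Local Open Scope quotient_scope.

(* [tensor U V] is the quotient of finite formal sums of pairs by the relation
   "every bilinear map to every vector space gives the same value"; this is the
   universal property of the tensor product, see [tlift_pi], [tlift_linear] and
   [tens_gen]. *)
Section Tensor.
Variables (K : fieldType) (U V : lmodType K).

Definition sweed (W : lmodType K) (B : U -> V -> W) (s : seq (U * V)) : W :=
  \sum_(p <- s) B p.1 p.2.

Definition tensor_eqv (s t : seq (U * V)) : bool :=
  `[< forall (W : lmodType K) (B : {bilinear U -> V -> W}),
        sweed B s = sweed B t >].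

Lemma tensor_eqv_refl : reflexive tensor_eqv.
Proof. by move=> s; apply/asboolP. Qed.

Lemma tensor_eqv_sym : symmetric tensor_eqv.
Proof. by move=> s t; apply/asboolP/asboolP => H W B; rewrite H. Qed.

Lemma tensor_eqv_trans : transitive tensor_eqv.
Proof.
by move=> t s u /asboolP H1 /asboolP H2; apply/asboolP => W B; rewrite H1.
Qed.

Canonical tensor_equiv :=
  EquivRel tensor_eqv tensor_eqv_refl tensor_eqv_sym tensor_eqv_trans.

Definition tensor := {eq_quot tensor_eqv}.
HB.instance Definition _ : EqQuotient _ tensor_eqv tensor :=
  EqQuotient.on tensor.
HB.instance Definition _ := Choice.on tensor.

Definition tens (u : U) (v : V) : tensor := \pi_tensor [:: (u, v)].

(* For t = \sum_i u_i (x) v_i, the value of Sweedler's expression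
   \sum_i B u_i v_i; it is independent of the representation of t only when B
   is bilinear, which is the case of every use below. *)
Definition tlift (W : lmodType K) (B : U -> V -> W) (t : tensor) : W :=
  sweed B (repr t).

Lemma tlift_pi (W : lmodType K) (B : U -> V -> W) s :
  bilinear_for *:%R *:%R B -> tlift B (\pi_tensor s) = sweed B s.
Proof.
move=> bB; pose m := bilinear_isBilinear.Build K U V W *:%R *:%R B bB.
pose B' : {bilinear U -> V -> W} := HB.pack B m.
have /asboolP/(_ W B') : tensor_eqv (repr (\pi_tensor s)) s.
  by apply/(@eqquotP _ _ tensor); rewrite reprK.
by [].
Qed.

Lemma tlift_bil (W : lmodType K) (B : {bilinear U -> V -> W}) s :
  tlift B (\pi_tensor s) = sweed B s.
Proof.
by apply: tlift_pi; split=> u a x y; rewrite ?linearPl ?linearPr.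
Qed.

Lemma tensorP (t u : tensor) :
  (forall (W : lmodType K) (B : {bilinear U -> V -> W}), tlift B t = tlift B u) ->
  t = u.
Proof.
move=> H; rewrite -[t]reprK -[u]reprK; apply/(@eqquotP _ _ tensor)/asboolP => W B.
exact: H.
Qed.

Definition tens0 : tensor := \pi_tensor [::].
Definition tens_add (t u : tensor) : tensor := \pi_tensor (repr t ++ repr u).
Definition tens_scale (a : K) (t : tensor) : tensor :=
  \pi_tensor [seq (a *: p.1, p.2) | p <- repr t].
Definition tens_opp (t : tensor) : tensor := tens_scale (-1) t.

Section Ops.
Variables (W : lmodType K) (B : {bilinear U -> V -> W}).

Lemma tlift_tens0 : tlift B tens0 = 0.
Proof. by rewrite tlift_bil /sweed big_nil. Qed.

Lemma tlift_tens_add t u : tlift B (tens_add t u) = tlift B t + tlift B u.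
Proof. by rewrite tlift_bil /sweed big_cat. Qed.

Lemma tlift_tens_scale a t : tlift B (tens_scale a t) = a *: tlift B t.
Proof.
rewrite tlift_bil /tlift /sweed big_map scaler_sumr.
by apply: eq_bigr => p _; rewrite linearZl_LR.
Qed.

End Ops.

Let tliftE := (tlift_tens_add, tlift_tens_scale, tlift_tens0).

Fact tens_addA : associative tens_add.
Proof. by move=> x y z; apply: tensorP => W B; rewrite !tliftE addrA. Qed.
Fact tens_addC : commutative tens_add.
Proof. by move=> x y; apply: tensorP => W B; rewrite !tliftE addrC. Qed.
Fact tens_add0 : left_id tens0 tens_add.
Proof. by move=> x; apply: tensorP => W B; rewrite !tliftE add0r. Qed.
Fact tens_addN : left_inverse tens0 tens_opp tens_add.
Proof. by move=> x; apply: tensorP => W B; rewrite !tliftE scaleN1r addNr. Qed.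

HB.instance Definition _ :=
  GRing.isZmodule.Build tensor tens_addA tens_addC tens_add0 tens_addN.

Fact tens_scaleA a b (t : tensor) :
  tens_scale a (tens_scale b t) = tens_scale (a * b) t.
Proof. by apply: tensorP => W B; rewrite !tliftE scalerA. Qed.
Fact tens_scale1 : left_id 1 tens_scale.
Proof. by move=> x; apply: tensorP => W B; rewrite !tliftE scale1r. Qed.
Fact tens_scaleDr : right_distributive tens_scale +%R.
Proof. by move=> a x y; apply: tensorP => W B; rewrite !tliftE scalerDr. Qed.
Fact tens_scaleDl (t : tensor) : {morph tens_scale^~ t : a b / a + b}.
Proof. by move=> a b; apply: tensorP => W B; rewrite !tliftE scalerDl. Qed.

HB.instance Definition _ := GRing.Zmodule_isLmodule.Build K tensor
  tens_scaleA tens_scale1 tens_scaleDr tens_scaleDl.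

Lemma tlift_linear (W : lmodType K) (B : U -> V -> W) :
  bilinear_for *:%R *:%R B -> linear (tlift B).
Proof.
move=> bB; pose m := bilinear_isBilinear.Build K U V W *:%R *:%R B bB.
pose B' : {bilinear U -> V -> W} := HB.pack B m.
by move=> a t u; rewrite (tlift_tens_add B') (tlift_tens_scale B').
Qed.

Lemma tlift_tens (W : lmodType K) (B : U -> V -> W) u v :
  bilinear_for *:%R *:%R B -> tlift B (tens u v) = B u v.
Proof. by move=> bB; rewrite tlift_pi // /sweed big_seq1. Qed.

Lemma tens_bilinear : bilinear_for *:%R *:%R tens.
Proof.
split=> w a x y; apply: tensorP => W B;
  by rewrite tlift_tens_add tlift_tens_scale !tlift_bil /sweed !big_seq1
             ?linearPl ?linearPr.
Qed.

Lemma tens_gen (t : tensor) : t = \sum_(p <- repr t) tens p.1 p.2.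
Proof.
apply: tensorP => W B.
have bB : bilinear_for *:%R *:%R B.
  by split=> u a x y; rewrite ?linearPl ?linearPr.
pose m := GRing.isLinear.Build K tensor W *:%R (tlift B) (tlift_linear bB).
pose L : {linear tensor -> W} := HB.pack (tlift B) m.
rewrite -[RHS]/(L _) linear_sum /=.
by apply: eq_bigr => p _; rewrite tlift_tens.
Qed.

End Tensor.

Arguments tensor {K} U V.
Arguments tens {K U V} u v.
Notation "u ⊗ v" := (tens u v) (at level 40, left associativity) : ring_scope.

(* the map f (x) g *)
Definition tmap (K : fieldType) (U V U' V' : lmodType K)
    (f : U -> U') (g : V -> V') (t : tensor U V) : tensor U' V' :=
  tlift (fun u v => f u ⊗ g v) t.

(* membership in the subspace A (x) B of U (x) V, for subspaces A, B *)
Definition in_tensor (K : fieldType) (U V : lmodType K) (A : {pred U})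
    (B : {pred V}) (t : tensor U V) : Prop :=
  exists2 s : seq (U * V),
    all (fun p => (p.1 \in A) && (p.2 \in B)) s &
    t = \sum_(p <- s) p.1 ⊗ p.2.

HB.mixin Record isBialgebra (K : fieldType) H & GRing.Algebra K H := {
  coprod : {linear H -> tensor H H};
  counit : {scalar H};
  coprodA : forall h : H,
    tlift (fun a b => tlift (fun c d => c ⊗ (d ⊗ b)) (coprod a)) (coprod h)
    = tlift (fun a b => a ⊗ coprod b) (coprod h);
  counit1l : forall h : H, tlift (fun a b => counit a *: b) (coprod h) = h;
  counit1r : forall h : H, tlift (fun a b => counit b *: a) (coprod h) = h;
  coprod1 : coprod 1 = 1 ⊗ 1;
  coprodM : forall x y : H,
    coprod (x * y) =
    tlift (fun a b => tlift (fun c d => (a * c) ⊗ (b * d)) (coprod y))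
      (coprod x);
  counit1 : counit 1 = 1;
  counitM : forall x y : H, counit (x * y) = counit x * counit y
}.

#[short(type="bialgType")]
HB.structure Definition Bialgebra (K : fieldType) :=
  {H of GRing.Algebra K H & isBialgebra K H}.

HB.mixin Record isGradedConnected (K : fieldType) H & Bialgebra K H := {
  homog : nat -> {pred H};
  homog_submod : forall n, submod_closed (homog n);
  homog_decomp : forall h : H, exists N (u : nat -> H),
    (forall n, u n \in homog n) /\ h = \sum_(n < N) u n;
  homog_indep : forall N (u : nat -> H), (forall n, u n \in homog n) ->
    \sum_(n < N) u n = 0 -> forall n, (n < N)%N -> u n = 0;
  homogM : forall n m (x y : H),
    x \in homog n -> y \in homog m -> x * y \in homog (n + m)%N;
  homog_coprod : forall n (h : H), h \in homog n ->
    exists2 T : nat -> tensor H H,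
      (forall p, (p <= n)%N -> in_tensor (homog p) (homog (n - p)%N) (T p)) &
      coprod h = \sum_(p < n.+1) T p;
  homog0 : forall h : H, h \in homog 0%N <-> exists c : K, h = c%:A
}.

#[short(type="gradedConnectedBialgType")]
HB.structure Definition GradedConnectedBialgebra (K : fieldType) :=
  {H of Bialgebra K H & isGradedConnected K H}.

Section Heisenberg.
Variables (K : fieldType) (H : gradedConnectedBialgType K).
Implicit Types (f g : {linear H -> H}) (alpha beta : {scalar H}) (h k x : H).

Definition is_hdecomp h (u : nat -> H) : Prop :=
  (forall n, u n \in homog n) /\
  exists N, (forall n, (N <= n)%N -> u n = 0) /\ h = \sum_(n < N) u n.

Lemma homog_lin n a x y :
  x \in homog n -> y \in homog n -> a *: x + y \in (homog n : {pred H}).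
Proof. by case: (homog_submod n (s := H)) => _ lin; apply: lin. Qed.

Lemma homog_zero n : (0 : H) \in homog n.
Proof. by case: (homog_submod n (s := H)). Qed.

Lemma is_hdecomp_ex h : exists u, is_hdecomp h u.
Proof.
have [N [u [uP ->]]] := homog_decomp h.
exists (fun n => if (n < N)%N then u n else 0); split.
  by move=> n; case: ifP => // _; apply: homog_zero.
exists N; split; first by move=> n; rewrite leqNgt => /negbTE ->.
by apply: eq_bigr => i _; rewrite ltn_ord.
Qed.

Lemma hdecomp_widen N M (u : nat -> H) :
  (forall n, (N <= n)%N -> u n = 0) -> (N <= M)%N ->
  \sum_(n < N) u n = \sum_(n < M) u n.
Proof.
move=> u0 NM; rewrite -!(big_mkord xpredT u) (big_cat_nat (leq0n N) NM) /=.
rewrite [X in _ = _ + X]big_nat_cond [X in _ = _ + X]big1 ?addr0 // => i.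
by rewrite andbT => /andP[Ni _]; apply: u0.
Qed.

Lemma is_hdecomp_lin a x y u v : is_hdecomp x u -> is_hdecomp y v ->
  is_hdecomp (a *: x + y) (fun n => a *: u n + v n).
Proof.
move=> [uh [N [u0 ->]]] [vh [M [v0 ->]]]; split.
  by move=> n; apply: homog_lin.
exists (maxn N M); split.
  by move=> n; rewrite geq_max => /andP[/u0 -> /v0 ->]; rewrite scaler0 addr0.
rewrite (hdecomp_widen u0 (leq_maxl N M)) (hdecomp_widen v0 (leq_maxr N M)).
by rewrite scaler_sumr -big_split.
Qed.

Lemma is_hdecomp_uniq x u v : is_hdecomp x u -> is_hdecomp x v -> u =1 v.
Proof.
move=> ux vx n; have [wh [N [w0 /esym ws]]] := is_hdecomp_lin (-1) ux vx.
have {}ws : \sum_(i < N) (-1 *: u i + v i) = 0 by rewrite ws scaleN1r addNr.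
have : -1 *: u n + v n = 0.
  have [nN|/w0 //] := ltnP n N.
  by have := @homog_indep K H N _ wh ws n nN.
by rewrite scaleN1r addrC => /eqP; rewrite subr_eq0 => /eqP.
Qed.

(* the projection of H onto H_n along the other components *)
Definition hproj (n : nat) h : H := sval (cid (is_hdecomp_ex h)) n.

Lemma hprojP h : is_hdecomp h (hproj^~ h).
Proof. exact: (svalP (cid (is_hdecomp_ex h))). Qed.

Fact hproj_linear n : linear (hproj n).
Proof.
move=> a x y; exact: (is_hdecomp_uniq (hprojP _)
  (is_hdecomp_lin a (hprojP x) (hprojP y))).
Qed.
HB.instance Definition _ n :=
  GRing.isLinear.Build K H H *:%R (hproj n) (hproj_linear n).

Fact heis_bilinear f g : bilinear_for *:%R *:%R (fun a b : H =>
  tlift (fun c d => d * g (b * c)) (coprod (f a))).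
Proof.
split=> [b|a] r x y /=.
  rewrite 2!linearP; apply: tlift_linear; split=> w s c d /=.
    by rewrite mulrDr linearD mulrDr -scalerAr linearZ /= -scalerAr.
  by rewrite mulrDl -scalerAl.
rewrite /tlift /sweed scaler_sumr -big_split /=; apply: eq_bigr => p _.
by rewrite mulrDl linearD mulrDr -scalerAl linearZ /= -scalerAr.
Qed.

(* (f # g)(h) = \sum f(h_1)_2 g(h_2 f(h_1)_1) *)
Definition heis f g h : H :=
  tlift (fun h1 h2 => tlift (fun c1 c2 => c2 * g (h2 * c1)) (coprod (f h1)))
    (coprod h).

Fact heis_linear f g : linear (heis f g).
Proof.
by move=> a x y; rewrite /heis linearP; apply/tlift_linear/heis_bilinear.
Qed.
HB.instance Definition _ f g :=
  GRing.isLinear.Build K H H *:%R (heis f g) (heis_linear f g).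

Definition conv f g h : H := tlift (fun h1 h2 => f h1 * g h2) (coprod h).

Fact conv_linear f g : linear (conv f g).
Proof.
move=> a x y; rewrite /conv linearP; apply: tlift_linear; split=> w r u v /=.
  by rewrite linearP mulrDl -scalerAl.
by rewrite linearP mulrDr -scalerAr.
Qed.
HB.instance Definition _ f g :=
  GRing.isLinear.Build K H H *:%R (conv f g) (conv_linear f g).

(* alpha | k *)
Definition rank1 alpha k x : H := alpha x *: k.

Fact rank1_linear alpha k : linear (rank1 alpha k).
Proof. by move=> a x y; rewrite /rank1 linearP scalerDl /= scalerA. Qed.
HB.instance Definition _ alpha k :=
  GRing.isLinear.Build K H H *:%R (rank1 alpha k) (rank1_linear alpha k).

Definition dual_mul alpha beta x : K :=
  tlift (W := K^o) (fun x1 x2 => alpha x1 * beta x2) (coprod x).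

Fact dual_mul_linear alpha beta : scalar (dual_mul alpha beta).
Proof.
move=> a x y; rewrite /dual_mul linearP.
have bB : bilinear_for (V := K^o) *:%R *:%R
    (fun x1 x2 => alpha x1 * beta x2).
  split=> w r u v /=; rewrite linearP /=.
    by rewrite mulrDl -mulrA.
  by rewrite mulrDr mulrCA.
exact: (tlift_linear bB a).
Qed.
HB.instance Definition _ alpha beta :=
  GRing.isLinear.Build K H K *%R (dual_mul alpha beta)
    (dual_mul_linear alpha beta).

Definition harpoon h beta x : K := beta (x * h).

Fact harpoon_linear h beta : scalar (harpoon h beta).
Proof. by move=> a x y; rewrite /harpoon mulrDl -scalerAl linearP. Qed.
HB.instance Definition _ h beta :=
  GRing.isLinear.Build K H K *%R (harpoon h beta) (harpoon_linear h beta).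

(* f belongs to End(H_p), viewed inside End(H) *)
Definition in_End_at (p : nat) f : Prop :=
  (forall h, h \in homog p -> f h \in homog p) /\
  (forall n h, n != p -> h \in homog n -> f h = 0).

Definition in_End_gr f : Prop :=
  forall n h, h \in homog n -> f h \in homog n.

(* the component f_n of a degree preserving f, viewed inside End(H) *)
Definition end_comp (n : nat) f : {linear H -> H} := f \o hproj n.

(* alpha belongs to (H_p)^*, extended by 0 *)
Definition in_dual_at (p : nat) alpha : Prop :=
  forall n h, n != p -> h \in homog n -> alpha h = 0.

(* the image of f lies in a finite dimensional subspace *)
Definition finite_rank f : Prop :=
  exists m (b : 'I_m -> H),
    forall h, exists c : 'I_m -> K, f h = \sum_(i < m) c i *: b i.

(* f belongs to the direct sum of the End(H_n), a <= n <= b *)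
Definition in_End_range (a b : nat) f : Prop :=
  exists2 F : nat -> {linear H -> H},
    (forall n, in_End_at n (F n)) &
    forall h, f h = \sum_(a <= n < b.+1) F n h.

(* f belongs to the direct sum of all the End_f(H_n) *)
Definition in_end_f f : Prop :=
  exists N, exists2 F : nat -> {linear H -> H},
    (forall n, in_End_at n (F n) /\ finite_rank (F n)) &
    forall h, f h = \sum_(n < N) F n h.

End Heisenberg.

(* Main.v *)
From HB Require Import structures.
Require Import Defs.
From mathcomp Require Import all_boot all_order all_algebra.

(* For [h] in [H_n], a term [f(h_1)_2 g(h_2 f(h_1)_1)] with [h_1] of degree [i]
   and [f(h_1)_1] of degree [j <= i] has argument of [g] in degree [n - i + j]
   and lies in [H_n]; it vanishes unless [i = p] and [n - i + j = q], that is
   [n = p + q - j] with [j <= p].  At [n = p + q] only [j = 0] survives, where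
   [f(h_1)_1 (x) f(h_1)_2] is [1 (x) f(h_1)]; at [n = p = q] both [h_2] and
   [f(h_1)_2] have degree 0, leaving [g(f(h))]. *)

Set Implicit Arguments.
Unset Strict Implicit.

Import GRing.Theory.
Local Open Scope ring_scope.

(** * Linear and bilinear maps given as bare functions *)

Section UnbundledLinear.
Context {K : fieldType} {V W : lmodType K}.
Implicit Types F : V -> W.

(** Sweedler integrands are lambda terms that carry only a proof of linearity, so [F] is packed
    locally into a linear map. *)
Lemma linear_fun_sum F (I : Type) (r : seq I) (G : I -> V) :
  linear F -> F (\sum_(i <- r) G i) = \sum_(i <- r) F (G i).
Proof.
move=> linF; pose m := GRing.isLinear.Build K V W *:%R F linF.
pose L : {linear V -> W} := HB.pack F m; exact: (linear_sum L).
Qed.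

Lemma linear_funZ F a x : linear F -> F (a *: x) = a *: F x.
Proof.
move=> linF; pose m := GRing.isLinear.Build K V W *:%R F linF.
pose L : {linear V -> W} := HB.pack F m; exact: (linearZ_LR L).
Qed.

Lemma linear_fun0 F : linear F -> F 0 = 0.
Proof. by move=> linF; rewrite -(scale0r (0 : V)) linear_funZ // scale0r. Qed.

End UnbundledLinear.

Section TensorLift.
Context {K : fieldType} {U V W : lmodType K}.
Implicit Types (B : U -> V -> W) (t : tensor U V).

Lemma tlift0 B : bilinear_for *:%R *:%R B -> tlift B 0 = 0.
Proof. by move=> /tlift_linear/linear_fun0. Qed.

Lemma tliftZ B a t : bilinear_for *:%R *:%R B -> tlift B (a *: t) = a *: tlift B t.
Proof. by move=> /tlift_linear/linear_funZ. Qed.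

Lemma tlift_sum B (I : Type) (r : seq I) (F : I -> tensor U V) :
  bilinear_for *:%R *:%R B ->
  tlift B (\sum_(i <- r) F i) = \sum_(i <- r) tlift B (F i).
Proof. by move=> /tlift_linear/linear_fun_sum. Qed.

Lemma tlift_tens_sum B (s : seq (U * V)) : bilinear_for *:%R *:%R B ->
  tlift B (\sum_(x <- s) tens x.1 x.2) = \sum_(x <- s) B x.1 x.2.
Proof.
by move=> bB; rewrite tlift_sum //; apply: eq_bigr => x _; rewrite tlift_tens.
Qed.

End TensorLift.

(** * Spans of finite lists *)

Section Span.
Context {K : fieldType} {V : lmodType K}.
Implicit Types (b : seq V) (x y : V).

(** A list of generators, unlike a family over ['I_m], can be enlarged and concatenated without
    reindexing. *)
Definition spanned b x : Prop :=
  exists c : nat -> K, x = \sum_(i < size b) c i *: b`_i.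

Lemma spanned0 b : spanned b 0.
Proof. by exists (fun=> 0); rewrite big1 // => i _; rewrite scale0r. Qed.

Lemma spannedD b x y : spanned b x -> spanned b y -> spanned b (x + y).
Proof.
move=> [c ->] [d ->]; exists (fun i => c i + d i); rewrite -big_split.
by apply: eq_bigr => i _; rewrite scalerDl.
Qed.

Lemma spannedZ b a x : spanned b x -> spanned b (a *: x).
Proof.
move=> [c ->]; exists (fun i => a * c i); rewrite scaler_sumr.
by apply: eq_bigr => i _; rewrite scalerA.
Qed.

Lemma spanned_sum b (I : eqType) (r : seq I) (F : I -> V) :
  (forall i, i \in r -> spanned b (F i)) -> spanned b (\sum_(i <- r) F i).
Proof.
move=> bF; rewrite big_seq; apply: big_ind => //; first exact: spanned0.
exact: spannedD.
Qed.

Lemma spanned_mem b x : x \in b -> spanned b x.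
Proof.
move=> xb; exists (fun i => (i == index x b)%:R).
have lt_x : (index x b < size b)%N by rewrite index_mem.
rewrite (bigD1 (Ordinal lt_x)) //= eqxx scale1r nth_index // big1 ?addr0 // => i.
by rewrite -val_eqE /= => /negbTE ->; rewrite scale0r.
Qed.

Lemma spanned_sub b b' x : {subset b <= b'} -> spanned b x -> spanned b' x.
Proof.
move=> sbb' [c ->]; apply: spanned_sum => i _.
by apply/spannedZ/spanned_mem/sbb'/mem_nth.
Qed.

End Span.

(** * Homogeneous components and the extreme terms of the coproduct *)

Section Graded.
Context {K : fieldType} {H : gradedConnectedBialgType K}.
Implicit Types (f g : {linear H -> H}) (h : H) (n p q : nat).

Lemma homog_sum n (I : eqType) (r : seq I) (F : I -> H) :
  (forall i, i \in r -> F i \in homog n) -> \sum_(i <- r) F i \in homog n.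
Proof.
move=> hF; rewrite big_seq; apply: (big_ind (fun x : H => x \in homog n)) => //.
  exact: homog_zero.
by move=> x y hx hy; rewrite -[x]scale1r homog_lin.
Qed.

Lemma hproj_homog n h : hproj n h \in homog n.
Proof. by have [uh _] := hprojP h. Qed.

Lemma hproj_id n m h : h \in homog m -> hproj n h = if n == m then h else 0.
Proof.
move=> hm; apply: (is_hdecomp_uniq _ _ (v := fun n => if n == m then h else 0)).
  exact: hprojP.
split=> [i|]; first by case: eqP => [->|] //; rewrite homog_zero.
exists m.+1; split=> [i|]; first by case: eqP => // ->; rewrite ltnn.
rewrite (bigD1 ord_max) //= eqxx big1 ?addr0 // => i.
by rewrite -val_eqE /= => /negbTE ->.
Qed.

Lemma hproj_sum h : exists N, h = \sum_(n < N) hproj n h.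
Proof. by have [_ [N [_ hE]]] := hprojP h; exists N. Qed.

Lemma homog_ext (W : lmodType K) (f g : {linear H -> W}) :
  (forall n h, h \in homog n -> f h = g h) -> f =1 g.
Proof.
move=> fg h; have [N ->] := hproj_sum h; rewrite !linear_sum.
by apply: eq_bigr => n _; apply: fg; apply: hproj_homog.
Qed.

(** Lists representing the components of bidegree [(i, n - i)] are joined into one Sweedler sum, so
    that later arguments go term by term with both degrees known. *)
Lemma coprod_homog n h : h \in homog n ->
  exists2 s : seq (H * H),
    (forall x, x \in s ->
       exists2 i, (i <= n)%N & x.1 \in homog i /\ x.2 \in homog (n - i)) &
    coprod h = \sum_(x <- s) tens x.1 x.2.
Proof.
move=> hn; have [T hT ->] := homog_coprod _ _ hn.
rewrite -(big_mkord xpredT T).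
(* Induction on the number of components summed; the bound by [n.+1] stays in the goal because [hT]
   holds only up to degree [n]. *)
have: (n.+1 <= n.+1)%N by []; elim: {1 3}n.+1 => [_|m IH lt_mn].
  by exists [::]; rewrite ?big_nil ?big_geq.
have [s hs sE] := IH (ltnW lt_mn); have [r hr rE] := hT m lt_mn.
exists (s ++ r); last by rewrite big_nat_recr // big_cat sE rE.
move=> x; rewrite mem_cat => /orP[/hs //|/(allP hr)/andP[]].
by exists m.
Qed.

(* By the counit axiom, the [H_0 (x) H_n] component of [coprod h] is
   [1 (x) h], as [H_0] is the ground field. *)
Lemma tlift_coprod_left (W : lmodType K) (B : H -> H -> W) n h :
  bilinear_for *:%R *:%R B -> h \in homog n ->
  (forall i u v, (0 < i)%N -> u \in homog i -> B u v = 0) ->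
  tlift B (coprod h) = B 1 h.
Proof.
move=> bB hn B0; have [s hs sE] := coprod_homog hn.
have bc : bilinear_for *:%R *:%R (fun a b : H => counit a *: b).
  split=> w a x y; first by rewrite linearP scalerDl /= scalerA.
  by rewrite /= scalerDr !scalerA mulrC.
have hE := counit1l h; rewrite sE tlift_tens_sum // in hE.
have := hproj_id n hn; rewrite eqxx -{1}hE linear_sum => hnE.
have [Bl B1] := (fun v => bB.1 v, bB.2 1).
rewrite sE tlift_tens_sum // -[in RHS]hnE linear_fun_sum // big_seq [RHS]big_seq.
apply: eq_bigr => x /hs[[|i] le_in [x1 x2]].
  have [c x1E] := (homog0 _).1 x1; rewrite x1E !linearZ /= counit1 mulr1.
  rewrite subn0 in x2; rewrite (hproj_id n x2) eqxx linear_funZ //.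
  exact: (linear_funZ (F := B^~ _)).
rewrite (B0 _ _ _ _ x1) // linearZ /= (hproj_id n x2) gtn_eqF ?scaler0.
  by rewrite linear_fun0.
by rewrite ltn_subrL (leq_trans _ le_in).
Qed.

(** Mirror image, from the right counit axiom: the surviving terms have left degree [n], hence a
    scalar on the right. *)
Lemma tlift_coprod_right (W : lmodType K) (B : H -> H -> W) n h :
  bilinear_for *:%R *:%R B -> h \in homog n ->
  (forall i u v, (i < n)%N -> u \in homog i -> B u v = 0) ->
  tlift B (coprod h) = B h 1.
Proof.
move=> bB hn B0; have [s hs sE] := coprod_homog hn.
have bc : bilinear_for *:%R *:%R (fun a b : H => counit b *: a).
  split=> w a x y; first by rewrite /= scalerDr !scalerA mulrC.
  by rewrite linearP scalerDl /= scalerA.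
(* Applying [hproj n] to the counit identity also removes the terms of left degree below [n], so
   [B h 1] can be compared with the left side term by term. *)
have hE := counit1r h; rewrite sE tlift_tens_sum // in hE.
have := hproj_id n hn; rewrite eqxx -{1}hE linear_sum => hnE.
have [Bl Br] := (bB.1 1, fun u => bB.2 u).
rewrite sE tlift_tens_sum // -[in RHS]hnE (linear_fun_sum (F := B^~ 1)) //.
rewrite big_seq [RHS]big_seq.
apply: eq_bigr => x /hs[i le_in [x1 x2]].
move: le_in; rewrite leq_eqVlt => /orP[/eqP i_n|lt_in].
  rewrite i_n subnn in x1 x2.
  have [c x2E] := (homog0 _).1 x2; rewrite x2E !linearZ /= counit1 mulr1.
  rewrite (hproj_id n x1) eqxx (linear_funZ (F := B^~ 1)) //.
  exact: linear_funZ.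
rewrite (B0 _ _ _ _ x1) // linearZ /= (hproj_id n x1) gtn_eqF // scaler0.
by rewrite (linear_fun0 (F := B^~ 1)).
Qed.

(** * Degrees in the Heisenberg product *)

Lemma heis_sum f g h (s : seq (H * H)) :
  coprod h = \sum_(x <- s) tens x.1 x.2 ->
  heis f g h =
  \sum_(x <- s) tlift (fun c d => d * g (x.2 * c)) (coprod (f x.1)).
Proof.
by move=> sE; rewrite -(tlift_tens_sum _ (heis_bilinear f g)) -sE.
Qed.

Lemma heis_inner_bilinear g h :
  bilinear_for *:%R *:%R (fun c d : H => d * g (h * c)).
Proof.
split=> w a x y /=; last by rewrite mulrDl -scalerAl.
by rewrite mulrDr linearD mulrDr -scalerAr linearZ /= -scalerAr.
Qed.

Lemma conv_bilinear f g : bilinear_for *:%R *:%R (fun a b : H => f a * g b).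
Proof.
split=> w r u v /=; first by rewrite linearP mulrDl -scalerAl.
by rewrite linearP mulrDr -scalerAr.
Qed.

Lemma in_End_at_gr p f : in_End_at p f -> in_End_gr f.
Proof.
move=> [fp f0] n h hn; have [np|np] := eqVneq n p; last first.
  by rewrite (f0 n) // homog_zero.
by move: hn; rewrite np => /fp.
Qed.

Lemma heis_End_gr f g : in_End_gr f -> in_End_gr g -> in_End_gr (heis f g).
Proof.
move=> grf grg n h hn; have [s hs sE] := coprod_homog hn.
rewrite /= (heis_sum _ _ sE).
apply: homog_sum => x /hs[i le_in [x1 x2]].
have [r hr ->] := coprod_homog (grf _ _ x1).
rewrite tlift_tens_sum; last exact: heis_inner_bilinear.
apply: homog_sum => y /hr[j le_ji [y1 y2]].
have -> : n = (i - j + (n - i + j))%N by rewrite addnCA !subnK.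
by apply: homogM => //; apply/grg/homogM.
Qed.

(** With [h_1] in degree [i], the argument of [g] has degree [n - i + j] for some [j <= i]; this
    gives the interval from [n - i] to [n]. *)
Lemma heis_eq0 f g n h : in_End_gr f -> h \in homog n ->
  (forall i, (i <= n)%N -> (forall u, u \in homog i -> f u = 0) \/
     (forall j u, (n - i <= j <= n)%N -> u \in homog j -> g u = 0)) ->
  heis f g h = 0.
Proof.
move=> grf hn fg0; have [s hs sE] := coprod_homog hn.
rewrite (heis_sum _ _ sE).
rewrite big_seq big1 // => x /hs[i le_in [x1 x2]].
have [r hr rE] := coprod_homog (grf _ _ x1).
have [f0|g0] := fg0 i le_in.
  by rewrite f0 // linear0; apply/tlift0/heis_inner_bilinear.
rewrite rE tlift_tens_sum; last exact: heis_inner_bilinear.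
rewrite big_seq big1 // => y /hr[j le_ji [y1 y2]].
rewrite (g0 (n - i + j)%N) ?mulr0 //; last exact: homogM.
by rewrite leq_addr -[leqRHS](subnK le_in) leq_add2l.
Qed.

Lemma end_comp_at f n : in_End_gr f -> in_End_at n (end_comp n f).
Proof.
move=> grf; split=> [h hn|m h nm hm] /=; first exact/grf/hproj_homog.
by rewrite (hproj_id n hm) eq_sym (negbTE nm) linear0.
Qed.

Lemma heis_End_range p q f g : in_End_at p f -> in_End_at q g ->
  in_End_range (maxn p q) (p + q) (heis f g).
Proof.
move=> fp gq; have [grf grg] := (in_End_at_gr fp, in_End_at_gr gq).
exists (fun n => end_comp n (heis f g)).
  by move=> n; apply/end_comp_at/heis_End_gr.
move=> h; have [N ->] := hproj_sum h.
rewrite linear_sum /=.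
under [RHS]eq_bigr do rewrite !linear_sum /=.
rewrite exchange_big /=; apply: eq_bigr => m _.
have hm := hproj_homog m h; set x := hproj m h in hm *.
under eq_bigr do rewrite (hproj_id _ hm).
(* On [x] in degree [m] only the summand of index [m] can be nonzero, and it is present exactly when
   [m] lies in the range. *)
have [/andP[le_m m_le]|m_out] := boolP (maxn p q <= m <= p + q)%N.
  rewrite (bigD1_seq (val m)) ?mem_index_iota ?iota_uniq ?ltnS ?le_m //= eqxx.
  rewrite big1 ?addr0 // => i /negbTE ->; exact: linear0.
have -> : heis f g x = 0.
  apply: (heis_eq0 grf hm) => i le_im.
  have [ip|ip] := eqVneq i p; last by left=> u; apply: fp.2.
  (* With [i = p] and [j = q], the bounds [p <= m], [q <= m] and [m - p <= q] would put [m] in the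
     range. *)
  right=> j u /andP[le_j j_le]; apply: gq.2; apply: contraNneq m_out => jq.
  by rewrite geq_max -ip -jq le_im j_le -leq_subLR.
rewrite big_nat big1 // => i /andP[le_i i_le].
case: eqP => [im|_]; last exact: linear0.
by rewrite -im le_i -ltnS i_le in m_out.
Qed.

Lemma heis_top p q f g : in_End_at p f -> in_End_at q g ->
  end_comp (p + q) (heis f g) =1 conv f g.
Proof.
move=> fp gq; have grf := in_End_at_gr fp.
apply: homog_ext => n h hn /=; rewrite (hproj_id _ hn).
have [s hs sE] := coprod_homog hn.
rewrite /conv sE tlift_tens_sum; last exact: conv_bilinear.
case: eqP => [pq_n|pq_n].
  rewrite (heis_sum _ _ sE).
  rewrite big_seq [RHS]big_seq; apply: eq_bigr => x /hs[i le_in [x1 x2]].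
  have [ip|ip] := eqVneq i p; last first.
    rewrite (fp.2 _ _ ip x1) linear0 mul0r.
    exact/tlift0/heis_inner_bilinear.
  (* Since [n - i = q], a left factor of degree [j > 0] gives [g] an argument of degree [q + j],
     where it vanishes. *)
  rewrite (tlift_coprod_left (n := i)) ?mulr1 //.
  - exact: heis_inner_bilinear.
  - exact: grf.
  move=> j u v j0 hu; rewrite (gq.2 (n - i + j)%N) ?mulr0 //.
    by rewrite -pq_n ip addKn -{2}[q]addn0 eqn_add2l -lt0n.
  exact: homogM.
(* In degrees other than [p + q] the convolution must vanish too: a nonzero term would need [i = p]
   and [n - i = q]. *)
rewrite linear0 big_seq big1 // => x /hs[i le_in [x1 x2]].
have [ip|ip] := eqVneq i p; last by rewrite (fp.2 _ _ ip x1) mul0r.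
rewrite (gq.2 _ _ _ x2) ?mulr0 //; apply/eqP => nq.
by apply: pq_n; rewrite -nq -ip subnKC.
Qed.

Lemma heis_bottom p f g : in_End_at p f -> in_End_at p g ->
  end_comp p (heis f g) =1 g \o f.
Proof.
move=> fp gp; apply: homog_ext => n h hn /=; rewrite (hproj_id _ hn).
have [pn|pn] := eqVneq p n; last first.
  by rewrite (fp.2 n) ?linear0 // eq_sym.
rewrite -pn in hn.
(* [f] kills left degrees below [p], which leaves [h ⊗ 1]; then [g] does the same to the coproduct
   of [f h]. *)
apply: (etrans (tlift_coprod_right (heis_bilinear f g) hn _)) => [i u v ip hu|].
  rewrite (fp.2 i) ?ltn_eqF // linear0.
  exact/tlift0/heis_inner_bilinear.
rewrite (tlift_coprod_right (heis_inner_bilinear g 1) (fp.1 _ hn)) ?mul1r //.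
by move=> i u v ip hu; rewrite mul1r (gp.2 i) ?mulr0 // ltn_eqF.
Qed.

(** * Rank-one endomorphisms *)

Lemma heis_rank1 (p q : nat) (alpha beta : {scalar H}) (k l : H) :
  k \in homog p -> in_dual_at q beta ->
  forall h : H,
    heis (rank1 alpha k) (rank1 beta l) h =
    \sum_(0 <= n < (minn p q).+1)
      tlift (fun k1 k2 =>
               rank1 (dual_mul alpha (harpoon k1 beta)) (k2 * l) h)
        (tmap (hproj n) (hproj (p - n)) (coprod k)).
Proof.
move=> kp betaq h; have [s hs sE] := coprod_homog kp.
(* Contribution of a term [u ⊗ v] of [coprod k] to either side of the formula at [h]. *)
pose D (u v : H) := rank1 (dual_mul alpha (harpoon u beta)) (v * l) h.
have DE u v : D u v =
    \sum_(x <- repr (coprod h)) (alpha x.1 * beta (x.2 * u)) *: (v * l).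
  by rewrite /D /rank1 /dual_mul /tlift /sweed scaler_suml.
have bD : bilinear_for *:%R *:%R D.
  split=> [v|u] a x y; rewrite /= !DE scaler_sumr -big_split;
    apply: eq_bigr => z _ /=.
    by rewrite mulrDr -scalerAr linearP mulrDr mulrCA scalerDl scalerA.
  by rewrite mulrDl -scalerAl scalerDr !scalerA mulrC.
have bDp n m : bilinear_for *:%R *:%R (fun u v : H => tens (hproj n u) (hproj m v)).
  have [tl tr] := tens_bilinear H H.
  by split=> w a x y; rewrite linearP; [apply: tl|apply: tr].
have D0 u v : (forall x, beta (x * u) = 0) -> D u v = 0.
  by move=> u0; rewrite DE big1 // => x _; rewrite u0 mulr0 scale0r.
(* Both [heis] and [D] are sums over the same [repr (coprod h)], so this half is an exchange of
   finite sums. *)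
transitivity (\sum_(x <- s) D x.1 x.2).
  under [RHS]eq_bigr do rewrite DE.
  rewrite exchange_big; apply: eq_bigr => x _ /=.
  rewrite linearZ /= tliftZ; last exact: heis_inner_bilinear.
  rewrite sE tlift_tens_sum; last exact: heis_inner_bilinear.
  rewrite scaler_sumr; apply: eq_bigr => y _.
  by rewrite /rank1 -scalerAr scalerA.
under [RHS]eq_bigr => n _.
  rewrite /tmap sE tlift_tens_sum // (tlift_sum _ _ bD).
  under eq_bigr do rewrite tlift_tens //; over.
(* A term of bidegree [(i, p - i)] is seen only by the projections with [n = i]; for [i] beyond
   [minn p q] its value under [D] has to be zero. *)
rewrite /= exchange_big big_seq [RHS]big_seq; apply: eq_bigr => x /hs[i le_ip [x1 x2]].
have D0l v : D 0 v = 0 by apply: D0 => y; rewrite mulr0 linear0.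
have [le_i|] := boolP (i <= minn p q)%N.
  rewrite (bigD1_seq i) ?mem_index_iota ?iota_uniq //= (hproj_id _ x1) eqxx.
  rewrite (hproj_id _ x2) eqxx big1 ?addr0 // => n /negbTE ni.
  by rewrite (hproj_id _ x1) ni D0l.
move=> lt_i; rewrite big_nat big1 => [|n /andP[_ lt_n]]; last first.
  rewrite (hproj_id _ x1); case: eqP => [ni|_]; last exact: D0l.
  by rewrite -ni -ltnS lt_n in lt_i.
(* Here [q < i], so every [y * x.1] has its components in degrees above [q], where [beta] is
   zero. *)
move: lt_i; rewrite leq_min le_ip -ltnNge /= => lt_qi; apply: D0 => y.
have [N ->] := hproj_sum y; rewrite mulr_suml linear_sum big1 // => n _.
apply: (betaq (n + i)%N); first by rewrite gtn_eqF // ltn_addl.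
by apply: homogM => //; apply: hproj_homog.
Qed.

(** * Finite rank and finite support *)

Lemma finite_rank_spanned f :
  finite_rank f <-> exists b, forall h, spanned b (f h).
Proof.
split=> [[m [b bf]]|[b bf]]; last first.
  by exists (size b), (fun i => b`_i) => h; have [c ->] := bf h; exists (c \o val).
exists (codom b) => h; have [c ->] := bf h; apply: spanned_sum => i _.
exact/spannedZ/spanned_mem/codom_f.
Qed.

(** Trades the direct sum for three conditions that can be checked on [heis f g] separately. *)
Lemma in_end_fP f :
  in_end_f f <->
  [/\ in_End_gr f, finite_rank f &
      exists N, forall n h, (N <= n)%N -> h \in homog n -> f h = 0].
Proof.
split=> [[N [F FP fE]]|[grf rkf [N f0]]]; last first.
  exists N, (fun n => end_comp n f) => [n|h].
    split; first exact: end_comp_at.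
    by have [m [b bf]] := rkf; exists m, b => h; apply: bf.
  have [_ [M [h0 hE]]] := hprojP h; rewrite [in LHS]hE.
  (* The components of [h] vanish from [M] on and [f] vanishes in degrees from [N] on; both sums are
     extended to the maximum of the two bounds. *)
  rewrite (hdecomp_widen h0 (leq_maxl M N)) linear_sum.
  apply/esym/(@hdecomp_widen K H N _ (fun n => f (hproj n h))) => [n le_Nn|].
    exact/(f0 n)/hproj_homog.
  exact: leq_maxr.
split.
- move=> n h hn; rewrite fE; apply: homog_sum => i _.
  exact: in_End_at_gr (FP i).1 n h hn.
- apply/finite_rank_spanned.
  (* One list has to serve all [n < N] at once, so lists for the successive images are
     concatenated. *)
  suff [b bF] : exists b, forall n h, (n < N)%N -> spanned b (F n h).
    by exists b => h; rewrite fE; apply: spanned_sum => i _; apply: bF.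
  elim: N {fE} => [|N [b bF]]; first by exists [::].
  have /finite_rank_spanned[d dF] := (FP N).2.
  exists (b ++ d) => n h; rewrite ltnS leq_eqVlt => /orP[/eqP ->|lt_nN].
    by apply: spanned_sub (dF h) => y; rewrite mem_cat orbC => ->.
  by apply: spanned_sub (bF n h lt_nN) => y; rewrite mem_cat => ->.
exists N => n h le_Nn hn; rewrite fE big1 // => i _.
by apply: ((FP i).1.2 n) => //; rewrite gtn_eqF // (leq_trans _ le_Nn).
Qed.

(* If [b] spans the image of [f] and [d] that of [g], the products of the right
   tensor factors of the [coprod b_i] with the [d_j] span the image of [f # g]. *)
Lemma heis_finite_rank f g :
  finite_rank f -> finite_rank g -> finite_rank (heis f g).
Proof.
move=> /finite_rank_spanned[b bf] /finite_rank_spanned[d dg].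
apply/finite_rank_spanned.
exists [seq z.2 * y | z <- flatten [seq repr (coprod x) | x <- b], y <- d] => h.
apply: spanned_sum => z _; have [c ->] := bf z.1.
rewrite linear_sum tlift_sum; last exact: heis_inner_bilinear.
apply: spanned_sum => i _.
rewrite linearZ tliftZ; last exact: heis_inner_bilinear.
apply/spannedZ/spanned_sum => w w_bi; have [e ->] := dg (z.2 * w.1).
rewrite mulr_sumr; apply: spanned_sum => j _; rewrite -scalerAr.
apply/spannedZ/spanned_mem/allpairs_f; last exact: mem_nth.
by apply/flatten_mapP; exists b`_i; first exact: mem_nth.
Qed.

Lemma heis_end_f f g : in_end_f f -> in_end_f g -> in_end_f (heis f g).
Proof.
move=> /in_end_fP[grf rkf [N f0]] /in_end_fP[grg rkg [M g0]].
apply/in_end_fP; split; [exact: heis_End_gr | exact: heis_finite_rank |].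
(* If [i >= N] then [f] kills [h_1]; otherwise [n - i >= M] and [g] kills its argument. *)
exists (N + M)%N => n h le_n hn; apply: (heis_eq0 grf hn) => i le_in.
have [le_Ni|lt_iN] := leqP N i; first by left=> u; apply: f0.
right=> j u /andP[le_j _]; apply: g0; apply: leq_trans le_j.
by rewrite leq_subRL // (leq_trans _ le_n) // leq_add2r ltnW.
Qed.

End Graded.

Theorem proposition4p9 (K : fieldType) (hK : [pchar K] =i pred0)
    (H : gradedConnectedBialgType K) :
  ((forall f g : {linear H -> H},
      in_End_gr f -> in_End_gr g -> in_End_gr (heis f g))
   /\
   (forall (p q : nat) (f g : {linear H -> H}),
      in_End_at p f -> in_End_at q g ->
      [/\ in_End_range (maxn p q) (p + q) (heis f g),
          end_comp (p + q) (heis f g) =1 conv f g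
        & p = q -> end_comp p (heis f g) =1 g \o f]))
  /\
  ((forall (p q : nat) (alpha beta : {scalar H}) (k l : H),
      in_dual_at p alpha -> k \in homog p ->
      in_dual_at q beta -> l \in homog q ->
      forall h : H,
        heis (rank1 alpha k) (rank1 beta l) h =
        \sum_(0 <= n < (minn p q).+1)
          tlift (fun k1 k2 =>
                   rank1 (dual_mul alpha (harpoon k1 beta)) (k2 * l) h)
            (tmap (hproj n) (hproj (p - n)) (coprod k)))
   /\
   (forall f g : {linear H -> H},
      in_end_f f -> in_end_f g -> in_end_f (heis f g))).
Proof.
split; split.
- by move=> f g; apply: heis_End_gr.
- move=> p q f g fp gq; split; [exact: heis_End_range | exact: heis_top |].
  by move=> pq; apply: heis_bottom; rewrite // pq.
- by move=> p q alpha beta k l _ kp betaq _; apply: heis_rank1.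
- by move=> f g; apply: heis_end_f.
Qed.
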